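(* Assume $\lambda(x,x)=1$ for all $x\in\Gamma$. Let $\mathcal{A}$ be a $(\Gamma,\lambda)$-commutative algebra which is a crossed product, let $\mathfrak{t}_\alpha\in\mathcal{A}^\alpha$ be an invertible element for each $\alpha\in\Gamma$, let $\boldsymbol{\nu}\in\Gamma^n$ and $P=\mathrm{diag}(\mathfrak{t}_{\nu_1},\dots,\mathfrak{t}_{\nu_n})$. Then for all $X\in\mathsf{M}^0(\boldsymbol{\nu};\mathcal{A})$ (so that $PXP^{-1}$ has entries in the commutative algebra $\mathcal{A}^0$), $$\Gamma\!\det{}^0(X)=\det(PXP^{-1}).$$
   Context: $\mathbb{K}$ is a field of characteristic zero and $\Gamma$ is a finitely generated abelian group. $\lambda:\Gamma\times\Gamma\to\mathbb{K}^\times$ is a commutation factor: biadditive with $\lambda(x,y)\lambda(y,x)=1$. A $(\Gamma,\lambda)$-commutative algebra is an associative unital $\Gamma$-graded $\mathbb{K}$-algebra $\mathcal{A}=\bigoplus_\gamma\mathcal{A}^\gamma$ with $ab=\lambda(\tilde a,\tilde b)ba$ for homogeneous $a,b$ ($\tilde a$ is the degree). It is a crossed product if $\mathcal{A}^\gamma$ contains an invertible element for each $\gamma\in\Gamma$. In the purely even case ($\lambda(x,x)=1$ for all $x$), $\mathfrak{S}(\lambda)$ is the (non-empty) set of biadditive maps $\varsigma:\Gamma\times\Gamma\to\mathbb{K}^\times$ with $\lambda(x,y)\varsigma(x,y)\varsigma(y,x)^{-1}=1$. For $\varsigma\in\mathfrak{S}(\lambda)$, $\underline{\mathcal{A}}$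 is the vector space $\mathcal{A}$ with the commutative product $a\star b=\varsigma(\tilde a,\tilde b)ab$. $\mathsf{M}^0(\boldsymbol{\nu};\mathcal{A})$ is the set of $n\times n$ matrices with $X^i_{\ j}\in\mathcal{A}^{\nu_j-\nu_i}$. The graded determinant is $\Gamma\!\det^0(X)=\det_{\underline{\mathcal{A}}}(J_\varsigma(X))$, where $J_\varsigma(X)$ has entries $\varsigma(\nu_i,\nu_j-\nu_i)^{-1}X^i_{\ j}$; it takes values in $\mathcal{A}^0$ and does not depend on the choice of $\varsigma\in\mathfrak{S}(\lambda)$. The $\det$ on the right-hand side of the claim is the usual determinant over $\mathcal{A}^0$. *)

(* Defs.v *)
From HB Require Import structures.
From mathcomp Require Import all_boot all_order all_algebra.

Set Implicit Arguments.
Unset Strict Implicit.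
Unset Printing Implicit Defensive.

Import GRing.Theory.
Local Open Scope ring_scope.

Definition finitely_generated (Gam : zmodType) : Prop :=
  exists g : seq Gam, forall x : Gam,
    exists c : nat -> int, x = \sum_(i < size g) g`_i *~ c i.

(* Biadditive maps Gam x Gam -> K^*: the target group is multiplicative. *)
Record bicharacter (K : fieldType) (Gam : zmodType) := Bicharacter {
  bichar_fun :> Gam -> Gam -> K;
  bichar_neq0 : forall x y, bichar_fun x y != 0;
  bicharDl : forall x y z,
    bichar_fun (x + y) z = bichar_fun x z * bichar_fun y z;
  bicharDr : forall x y z,
    bichar_fun x (y + z) = bichar_fun x y * bichar_fun x z
}.

Record commutation_factor (K : fieldType) (Gam : zmodType) :=
  CommutationFactor {
    comfac_bichar :> bicharacter K Gam;
    comfacP : forall x y, comfac_bichar x y * comfac_bichar y x = 1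
  }.

(* The set S(lam). *)
Record twist (K : fieldType) (Gam : zmodType)
    (lam : commutation_factor K Gam) := Twist {
  twist_bichar :> bicharacter K Gam;
  twistP : forall x y, lam x y * twist_bichar x y * (twist_bichar y x)^-1 = 1
}.

(* (Gam, lam)-commutative algebras. The homogeneous components are linear
   subspaces of the algebra; gc_span and gc_free say that the algebra is their
   internal direct sum. *)
Record gcAlg (K : fieldType) (Gam : zmodType)
    (lam : commutation_factor K Gam) := GcAlg {
  gc_alg :> algType K;
  gc_comp : Gam -> {pred gc_alg};
  gc_submod : forall x, submod_closed (gc_comp x);
  gc_span : forall a : gc_alg, exists (s : seq Gam) (f : Gam -> gc_alg),
    (forall x, f x \in gc_comp x) /\ a = \sum_(x <- s) f x;
  gc_free : forall (s : seq Gam) (f : Gam -> gc_alg),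
    uniq s -> (forall x, f x \in gc_comp x) -> \sum_(x <- s) f x = 0 ->
    forall x, x \in s -> f x = 0;
  gc_1 : 1 \in gc_comp 0;
  gc_M : forall x y a b,
    a \in gc_comp x -> b \in gc_comp y -> a * b \in gc_comp (x + y);
  gc_C : forall x y a b,
    a \in gc_comp x -> b \in gc_comp y -> a * b = lam x y *: (b * a)
}.

Arguments gc_comp {K Gam lam} A x : rename.

Definition invertible (R : pzRingType) (a : R) : Prop :=
  exists b, a * b = 1 /\ b * a = 1.

Definition crossed_product (K : fieldType) (Gam : zmodType)
    (lam : commutation_factor K Gam) (A : gcAlg lam) : Prop :=
  forall x, exists2 a : A, a \in gc_comp A x & invertible a.

Section Bicharacters.
Variables (K : fieldType) (Gam : zmodType) (b : bicharacter K Gam).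

Lemma bichar0l x : b 0 x = 1.
Proof.
apply: (mulfI (bichar_neq0 b 0 x)).
by rewrite -bicharDl addr0 mulr1.
Qed.

Lemma bichar0r x : b x 0 = 1.
Proof.
apply: (mulfI (bichar_neq0 b x 0)).
by rewrite -bicharDr addr0 mulr1.
Qed.

End Bicharacters.

Section Components.
Variables (K : fieldType) (Gam : zmodType) (lam : commutation_factor K Gam).
Variable A : gcAlg lam.

Lemma gc_0 x : 0 \in gc_comp A x.
Proof. by case: (gc_submod A x). Qed.

Lemma gc_Z x k (a : A) : a \in gc_comp A x -> k *: a \in gc_comp A x.
Proof.
by case: (gc_submod A x) => h0 h xa; rewrite -[k *: a]addr0; apply: h.
Qed.

Lemma gc_D x (a b : A) :
  a \in gc_comp A x -> b \in gc_comp A x -> a + b \in gc_comp A x.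
Proof.
by case: (gc_submod A x) => h0 h xa xb; rewrite -[a]scale1r; apply: h.
Qed.

Lemma gc_N x (a : A) : a \in gc_comp A x -> - a \in gc_comp A x.
Proof. by move=> xa; rewrite -scaleN1r; apply: gc_Z. Qed.

(* A homogeneous decomposition is a list of pairs (degree, element of that
   degree); repeated degrees are allowed. *)
Definition homog (d : seq (Gam * A)) := all (fun p => p.2 \in gc_comp A p.1) d.
Definition total (d : seq (Gam * A)) : A := \sum_(p <- d) p.2.

Lemma gc_dec_ex (a : A) : exists d, homog d && (total d == a).
Proof.
have [s [f [fP ->]]] := gc_span a.
exists [seq (x, f x) | x <- s]; rewrite /total big_map eqxx andbT.
by apply/allP => _ /mapP[x _ ->] /=.
Qed.

Definition gc_dec (a : A) : seq (Gam * A) := xchoose (gc_dec_ex a).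

Lemma gc_dec_homog a : homog (gc_dec a).
Proof. by case/andP: (xchooseP (gc_dec_ex a)). Qed.

Lemma gc_decK a : total (gc_dec a) = a.
Proof. by case/andP: (xchooseP (gc_dec_ex a)) => _ /eqP. Qed.

Lemma homog_cat d e : homog (d ++ e) = homog d && homog e.
Proof. exact: all_cat. Qed.

Lemma total_cat d e : total (d ++ e) = total d + total e.
Proof. exact: big_cat. Qed.

Lemma homog_cons p d : homog (p :: d) = (p.2 \in gc_comp A p.1) && homog d.
Proof. by []. Qed.

Lemma homog_sum0 (V : nmodType) (F : Gam -> A -> V) d :
    (forall x, F x 0 = 0) -> (forall x, {morph F x : a b / a + b}) ->
  homog d -> total d = 0 -> \sum_(p <- d) F p.1 p.2 = 0.
Proof.
move=> F0 FD hd td.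
pose s := undup [seq p.1 | p <- d].
pose g x : A := \sum_(p <- d | p.1 == x) p.2.
have gP x : g x \in gc_comp A x.
  rewrite /g big_seq_cond; elim/big_ind: _ => [||p /andP[pd /eqP <-]].
  - exact: gc_0.
  - by move=> a b; apply: gc_D.
  - exact: (allP hd).
have split_sum (W : nmodType) (G : Gam * A -> W) :
    \sum_(p <- d) G p = \sum_(x <- s) \sum_(p <- d | p.1 == x) G p.
  rewrite (exchange_big_dep predT) //= [LHS]big_seq [RHS]big_seq.
  apply: eq_bigr => p pd.
  rewrite big_mkcond (bigD1_seq p.1) ?undup_uniq ?mem_undup ?map_f //= eqxx.
  by rewrite big1 ?addr0 // => x /negPf; rewrite eq_sym => ->.
have gs : \sum_(x <- s) g x = 0 by rewrite -[RHS]td /total split_sum.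
have g0 := gc_free (undup_uniq _) gP gs.
rewrite split_sum big1_seq // => x /andP[_ xs].
rewrite (eq_bigr (fun p => F x p.2)) => [|p /eqP -> //].
by rewrite -(big_morph (F x) (FD x) (F0 x)) -/(g x) g0.
Qed.

Lemma homog_sum (V : zmodType) (F : Gam -> A -> V) d e :
    (forall x, {morph F x : a b / a + b}) ->
    homog d -> homog e -> total d = total e ->
  \sum_(p <- d) F p.1 p.2 = \sum_(p <- e) F p.1 p.2.
Proof.
move=> FD hd he tde.
have F0 x : F x 0 = 0 by apply: (addrI (F x 0)); rewrite -FD !addr0.
have FN x a : F x (- a) = - F x a.
  by apply: (addrI (F x a)); rewrite -FD !subrr F0.
pose e' := [seq (p.1, - p.2) | p <- e].
have he' : homog e'.
  by apply/allP => _ /mapP[p pe ->] /=; apply: gc_N; apply: (allP he).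
have te' : total e' = - total e by rewrite /total big_map sumrN.
have := @homog_sum0 _ F (d ++ e') F0 FD.
rewrite homog_cat hd he' total_cat te' tde subrr big_cat big_map /=.
move=> /(_ isT erefl) /eqP; under [X in _ + X]eq_bigr do rewrite FN.
by rewrite sumrN subr_eq0 => /eqP.
Qed.

End Components.

(* The vector space A, to be endowed with the product twisted by s. *)
Definition twisted (K : fieldType) (Gam : zmodType)
  (lam : commutation_factor K Gam) (A : gcAlg lam) (s : twist lam) : Type := A.

Section TwistedAlgebra.
Variables (K : fieldType) (Gam : zmodType) (lam : commutation_factor K Gam).
Variables (A : gcAlg lam) (s : twist lam).

HB.instance Definition _ := GRing.Lmodule.on (twisted A s).

(* Bilinear extension of a * b = s x y *: (a * b), for a of degree x and b of
   degree y. *)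
Definition star (a b : A) : A :=
  \sum_(p <- gc_dec a) \sum_(q <- gc_dec b) s p.1 q.1 *: (p.2 * q.2).

Lemma starE d e : homog d -> homog e ->
  star (total d) (total e) =
  \sum_(p <- d) \sum_(q <- e) s p.1 q.1 *: (p.2 * q.2).
Proof.
move=> hd he; rewrite /star.
pose F x a := \sum_(q <- gc_dec (total e)) s x q.1 *: (a * q.2).
rewrite (@homog_sum _ _ _ _ _ F _ d) ?gc_dec_homog ?gc_decK //; last first.
  move=> x a b; rewrite /F -big_split; apply: eq_bigr => q _.
  by rewrite mulrDl scalerDr.
apply: eq_bigr => p _; rewrite /F.
apply: (@homog_sum _ _ _ _ _ (fun y b => s p.1 y *: (p.2 * b)));
  rewrite ?gc_dec_homog ?gc_decK //.
by move=> y a b; rewrite mulrDr scalerDr.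
Qed.

Lemma star_homog x y (a b : A) : a \in gc_comp A x -> b \in gc_comp A y ->
  star a b = s x y *: (a * b).
Proof.
move=> xa yb.
have := @starE [:: (x, a)] [:: (y, b)].
by rewrite /total !big_seq1 /= xa yb => ->.
Qed.

Lemma twistC x y : s x y * lam x y = s y x.
Proof.
have /(congr1 (fun k => k * s y x)) := twistP s x y.
by rewrite mulfVK ?bichar_neq0 // mul1r mulrC.
Qed.

Lemma starC : commutative star.
Proof.
move=> a b; rewrite /star exchange_big /= [LHS]big_seq [RHS]big_seq.
apply: eq_bigr => q qb; rewrite [LHS]big_seq [RHS]big_seq.
apply: eq_bigr => p pa.
have hp := allP (gc_dec_homog a) _ pa; have hq := allP (gc_dec_homog b) _ qb.
by rewrite (gc_C hp hq) scalerA twistC.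
Qed.

Lemma star1 : left_id (1 : A) star.
Proof.
move=> a; rewrite -{2}(gc_decK a) -{1}(gc_decK a).
have h1 : homog [:: (0, 1 : A)] by rewrite homog_cons /= gc_1.
have -> : 1 = total [:: (0, 1 : A)] by rewrite /total big_seq1.
rewrite starE ?gc_dec_homog // big_seq1.
by apply: eq_bigr => q _; rewrite /= bichar0l scale1r mul1r.
Qed.

Lemma starD : left_distributive star +%R.
Proof.
move=> a b c.
rewrite -[in LHS](gc_decK a) -[in LHS](gc_decK b) -[in LHS](gc_decK c).
by rewrite -total_cat starE ?homog_cat ?gc_dec_homog // big_cat.
Qed.

Lemma starA : associative star.
Proof.
pose tensor (d e : seq (Gam * A)) :=
  [seq (p.1 + q.1, s p.1 q.1 *: (p.2 * q.2)) | p <- d, q <- e].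
have tensorP d e : homog d -> homog e -> homog (tensor d e).
  move=> hd he; apply/allP => _ /allpairsP[[p q] /= [pd qe ->]] /=.
  by apply/gc_Z/gc_M; [apply: (allP hd) | apply: (allP he)].
have tensorE d e : homog d -> homog e ->
    star (total d) (total e) = total (tensor d e).
  by move=> hd he; rewrite starE // /total big_allpairs_dep.
move=> a b c; rewrite -(gc_decK a) -(gc_decK b) -(gc_decK c).
have [[ha hb] hc] := (gc_dec_homog a, gc_dec_homog b, gc_dec_homog c).
move: (gc_dec a) (gc_dec b) (gc_dec c) ha hb hc => d e f hd he hf.
rewrite (tensorE e f) // (tensorE d e) // !tensorE ?tensorP //.
rewrite /total !big_allpairs_dep; apply: eq_bigr => p _.
rewrite !big_allpairs_dep; apply: eq_bigr => q _; apply: eq_bigr => r _ /=.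
rewrite -scalerAr -scalerAl !scalerA mulrA bicharDl bicharDr.
by congr (_ *: _); rewrite mulrC mulrA -!mulrA [LHS]mulrA [LHS]mulrC.
Qed.

HB.instance Definition _ := GRing.Zmodule_isComNzRing.Build (twisted A s)
  starA starC star1 starD (oner_neq0 A).

End TwistedAlgebra.

Section DegreeZero.
Variables (K : fieldType) (Gam : zmodType) (lam : commutation_factor K Gam).
Variable A : gcAlg lam.

Definition deg0_pred : {pred A} := gc_comp A 0.

Lemma deg0_subring : subring_closed deg0_pred.
Proof.
split=> [|a b ha hb|a b ha hb]; first exact: gc_1.
  by apply: gc_D => //; apply: gc_N.
by rewrite -[deg0_pred]/(gc_comp A 0) -[0]addr0; apply: gc_M.
Qed.

HB.instance Definition _ := GRing.isSubringClosed.Build A deg0_pred deg0_subring.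

Record deg0 := Deg0 { deg0_val : A; _ : deg0_val \in deg0_pred }.

HB.instance Definition _ := [isSub for deg0_val].
HB.instance Definition _ := [Choice of deg0 by <:].
HB.instance Definition _ := [SubChoice_isSubNzRing of deg0 by <:].

Lemma deg0_mulC : @commutative deg0 deg0 *%R.
Proof.
move=> a b; apply/val_inj; rewrite !rmorphM /=.
by rewrite (gc_C (valP a) (valP b)) bichar0l scale1r.
Qed.

HB.instance Definition _ :=
  GRing.PzRing_hasCommutativeMul.Build deg0 deg0_mulC.

End DegreeZero.

Section GradedDeterminant.
Variables (K : fieldType) (Gam : zmodType) (lam : commutation_factor K Gam).
Variables (A : gcAlg lam) (n : nat) (nu : 'I_n -> Gam).

Definition gmx0 (X : 'M[A]_n) : Prop :=
  forall i j, X i j \in gc_comp A (nu j - nu i).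

Definition Jmx (s : twist lam) (X : 'M[A]_n) : 'M[twisted A s]_n :=
  \matrix_(i, j) ((s (nu i) (nu j - nu i))^-1 *: X i j : A).

Definition gdet0 (s : twist lam) (X : 'M[A]_n) : A := \det (Jmx s X).

End GradedDeterminant.

(* Main.v *)
Require Import Defs.
From HB Require Import structures.
From mathcomp Require Import all_boot all_order all_algebra.

Set Implicit Arguments.
Unset Strict Implicit.
Unset Printing Implicit Defensive.

Import GRing.Theory.
Local Open Scope ring_scope.

(** For the star product, J_s(X) is conjugate, by the diagonal matrix with
    entries t (nu i), to P X P^-1: the scalars s(nu_i, nu_j - nu_i)^-1 in the
    definition of J_s are those that cancel the twist of the left
    multiplication by t (nu i). The entries of P X P^-1 have degree 0, where the
    star product agrees with the original one, and the determinant over the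
    commutative algebra (A, star) is invariant under conjugation. *)

Section HomogeneousInverse.
Variables (K : fieldType) (Gam : zmodType) (lam : commutation_factor K Gam).
Variable A : gcAlg lam.

(* By uniqueness of the decomposition of [1], the component of degree [- x] of
   an inverse of [a] is already a right inverse of [a]. *)
Lemma gc_inv x (a b : A) :
  a \in gc_comp A x -> a * b = 1 -> b * a = 1 -> b \in gc_comp A (- x).
Proof.
move=> xa ab1 ba1.
pose b' := \sum_(p <- gc_dec b | p.1 == - x) p.2.
have b'P : b' \in gc_comp A (- x).
  rewrite /b' big_seq_cond; elim/big_ind: _ => [||p /andP[pb /eqP <-]].
  - exact: gc_0.
  - by move=> c d; apply: gc_D.
  - exact: (allP (gc_dec_homog b)).
suff ab' : a * b' = 1 by rewrite -[b]mulr1 -ab' mulrA ba1 mul1r.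
pose d := [seq (x + p.1, a * p.2) | p <- gc_dec b].
(* Projection to degree 0. It is additive in [c], so it takes the same value on the two homogeneous
   decompositions of [1 = a * b], namely [d] and the trivial one; on [d] it gives [a * b']. *)
pose F (y : Gam) (c : A) : A := if y == 0 then c else 0.
have FD y : {morph F y : c e / c + e}.
  by move=> c e; rewrite /F; case: eqP => // _; rewrite addr0.
have hd : homog d.
  apply/allP => _ /mapP[p pb ->] /=.
  by apply: gc_M => //; apply: (allP (gc_dec_homog b)).
have h1 : homog [:: (0, 1 : A)] by rewrite homog_cons /= gc_1.
have td : Defs.total d = Defs.total [:: (0, 1 : A)].
  by rewrite /Defs.total big_map big_seq1 /= -mulr_sumr -/(Defs.total _) gc_decK.
have := homog_sum FD hd h1 td.
rewrite big_seq1 big_map /= /F eqxx => <-.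
rewrite /b' mulr_sumr [LHS]big_mkcond /=; apply: eq_bigr => p _.
by rewrite addrC addr_eq0.
Qed.

End HomogeneousInverse.

Section DegreeZeroTwisted.
Variables (K : fieldType) (Gam : zmodType) (lam : commutation_factor K Gam).
Variables (A : gcAlg lam) (s : twist lam).

(** Named so that it can carry a ring morphism structure, through which determinants over the degree
    0 subring pass to the star product. *)
Definition deg0_twisted (a : deg0 A) : twisted A s := val a.

Lemma deg0_twisted_is_zmod_morphism : zmod_morphism deg0_twisted.
Proof. exact: (raddfB (val : deg0 A -> A)). Qed.

Lemma deg0_twisted_is_monoid_morphism : monoid_morphism deg0_twisted.
Proof.
split=> // a b; rewrite /deg0_twisted rmorphM /=.
by rewrite [RHS](star_homog s (valP a) (valP b)) bichar0l scale1r.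
Qed.

HB.instance Definition _ := GRing.isZmodMorphism.Build (deg0 A) (twisted A s)
  deg0_twisted deg0_twisted_is_zmod_morphism.
HB.instance Definition _ := GRing.isMonoidMorphism.Build (deg0 A) (twisted A s)
  deg0_twisted deg0_twisted_is_monoid_morphism.

End DegreeZeroTwisted.

(** Off the diagonal the product gives [d i * Pinv i j = 0], and a left inverse of [d i] cancels it;
    [R] need not be commutative. *)
Lemma diag_mx_inv (R : pzRingType) n (d : 'I_n -> R) (Pinv : 'M[R]_n) :
    (forall i, invertible (d i)) ->
    diag_mx (\row_i d i) *m Pinv = 1%:M ->
  Pinv = diag_mx (\row_i Pinv i i).
Proof.
move=> d_inv dP1; apply/matrixP => i j; rewrite !mxE.
have [->|ij] := eqVneq i j; first by rewrite mulr1n.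
have [c [_ cd1]] := d_inv i.
have := congr1 (fun M : 'M_n => M i j) dP1.
rewrite mul_diag_mx !mxE (negPf ij) => dP0.
by rewrite mulr0n -[LHS]mul1r -cd1 -mulrA dP0 mulr0.
Qed.

Lemma det_conj (R : comPzRingType) n (D E M : 'M[R]_n) :
  D *m E = 1%:M -> \det (D *m M *m E) = \det M.
Proof.
by move=> DE; rewrite !det_mulmx mulrAC -det_mulmx DE det1 mul1r.
Qed.

Section GradedConjugation.
Variables (K : fieldType) (Gam : zmodType) (lam : commutation_factor K Gam).
Variables (A : gcAlg lam) (s : twist lam) (n : nat) (nu : 'I_n -> Gam).

Lemma gdet0_conj (t u : 'I_n -> A) (X : 'M[A]_n) (Y : 'M[deg0 A]_n) :
    (forall i, t i \in gc_comp A (nu i)) ->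
    (forall i, u i \in gc_comp A (- nu i)) ->
    (forall i, t i * u i = 1) -> gmx0 nu X ->
    (forall i j, val (Y i j) = t i * X i j * u j) ->
  gdet0 nu s X = val (\det Y).
Proof.
move=> tP uP tu1 hX YE.
pose D : 'M[twisted A s]_n := diag_mx (\row_i (t i : twisted A s)).
(* The star product of [t i] and [u i] is [s (nu i) (- nu i)] times 1, so the scalar makes the
   entries of [E] star inverses of the [t i]. *)
pose E : 'M[twisted A s]_n :=
  diag_mx (\row_i ((s (nu i) (- nu i))^-1 *: u i : A)).
have DE : D *m E = 1%:M.
  apply/matrixP => i j; rewrite mul_diag_mx !mxE.
  have [->|_] := eqVneq i j; last by rewrite !mulr0n mulr0.
  rewrite !mulr1n [LHS](star_homog s (tP j) (gc_Z _ (uP j))).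
  by rewrite -scalerAr scalerA divff ?bichar_neq0 // scale1r tu1.
have DJE : D *m Jmx nu s X *m E = map_mx (@deg0_twisted _ _ _ A s) Y.
  apply/matrixP => i j; rewrite mul_diag_mx mul_mx_diag !mxE.
  have tX := star_homog s (tP i) (gc_Z (s (nu i) (nu j - nu i))^-1 (hX i j)).
  rewrite -scalerAr scalerA divff ?bichar_neq0 // scale1r in tX.
  rewrite [LHS](congr1 (fun a => star s a _) tX).
  (* In degree [nu j], right star multiplication by [u j] is twisted by [s (nu j) (- nu j)], exactly
     the scalar cancelled by [E]. *)
  have tXP : t i * X i j \in gc_comp A (nu j).
    by rewrite -(subrKC (nu i) (nu j)); apply: gc_M.
  rewrite (star_homog s tXP (gc_Z _ (uP j))).
  by rewrite -scalerAr scalerA divff ?bichar_neq0 // scale1r -YE.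
by rewrite /gdet0 -(det_conj _ DE) DJE det_map_mx.
Qed.

End GradedConjugation.

Theorem proposition5p11 (K : fieldType) (charK : [pchar K] =i pred0)
    (Gam : zmodType) (fgGam : finitely_generated Gam)
    (lam : commutation_factor K Gam) (lam_even : forall x, lam x x = 1)
    (A : gcAlg lam) (cpA : crossed_product A)
    (t : Gam -> A) (t_deg : forall x, t x \in gc_comp A x)
    (t_inv : forall x, invertible (t x))
    (n : nat) (nu : 'I_n -> Gam)
    (P Pinv : 'M[A]_n) (P_def : P = diag_mx (\row_i t (nu i)))
    (PPinv : P *m Pinv = 1%:M) (PinvP : Pinv *m P = 1%:M)
    (s : twist lam) (X : 'M[A]_n) (hX : gmx0 nu X) :
  exists Y : 'M[deg0 A]_n,
    map_mx val Y = P *m X *m Pinv /\ gdet0 nu s X = val (\det Y).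
Proof.
have tu1 i : t (nu i) * Pinv i i = 1.
  have := congr1 (fun M : 'M_n => M i i) PPinv.
  by rewrite P_def mul_diag_mx !mxE eqxx.
have ut1 i : Pinv i i * t (nu i) = 1.
  have := congr1 (fun M : 'M_n => M i i) PinvP.
  by rewrite P_def mul_mx_diag !mxE eqxx.
(* No degree is assumed for the entries of [Pinv]; both one-sided identities serve to place the
   diagonal ones in degree [- nu i]. *)
have uP i := gc_inv (t_deg (nu i)) (tu1 i) (ut1 i).
have PXPE i j : (P *m X *m Pinv) i j = t (nu i) * X i j * Pinv j j.
  rewrite P_def in PPinv *.
  rewrite (diag_mx_inv (fun i => t_inv (nu i)) PPinv).
  by rewrite mul_diag_mx mul_mx_diag !mxE eqxx mulr1n.
have PXP0 i j : (P *m X *m Pinv) i j \in gc_comp A 0.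
  rewrite PXPE -(subrr (nu j)).
  by apply: gc_M => //; rewrite -[nu j](subrKC (nu i)); apply: gc_M.
exists (\matrix_(i, j) Deg0 (PXP0 i j)); split.
  by apply/matrixP => i j; rewrite !mxE.
apply: (gdet0_conj s (fun i => t_deg (nu i)) uP tu1 hX) => i j.
by rewrite mxE -PXPE.
Qed.
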